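(* Let $n,m\in\mathbb{N}$, let $\alpha_2,\dots,\alpha_m\in\mathbb{R}$ and let $\gamma_1,\dots,\gamma_n\in\mathbb{R}$ satisfy $\sum_{k=1}^n\gamma_k=0$. Define $f=(u_1,\dots,u_n):\mathbb{R}^n\to\mathbb{R}^n$ by $$u_k(X)=x_k+\gamma_k\left[\alpha_2(x_1+\cdots+x_n)^2+\alpha_3(x_1+\cdots+x_n)^3+\cdots+\alpha_m(x_1+\cdots+x_n)^m\right],\qquad k=1,\dots,n,$$ where $X=(x_1,\dots,x_n)\in\mathbb{R}^n$. Let $A,B:\mathbb{R}^n\to\mathbb{R}^n$ be linear maps with $\det A\cdot\det B\neq 0$, and put $F=A\circ f\circ B$. Then the Jacobian conjecture is true for $F$; that is, if $\det DF$ is identically equal to a non-zero constant, then $F$ is invertible.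
   Context: $\mathbb{N}=\{1,2,3,\dots\}$; for $m=1$ the bracketed sum is empty (equal to $0$). A map $\mathbb{R}^n\to\mathbb{R}^n$ is a polynomial map if each of its components is a polynomial in $x_1,\dots,x_n$. A polynomial map is called invertible if it has an inverse map which is also a polynomial map. $DF$ denotes the Jacobian matrix of $F$. The Jacobian conjecture asserts that every polynomial map whose Jacobian determinant is identically equal to a non-zero constant is (globally) invertible; ''the Jacobian conjecture is true for $F$'' means that this assertion holds for the particular map $F$. *)

(* Defs.v *)
From mathcomp Require Import all_boot all_order all_algebra.
From mathcomp Require mpoly.
From mathcomp Require Import all_classical all_reals all_analysis.

Set Implicit Arguments.
Unset Strict Implicit.
Unset Printing Implicit Defensive.

Import Order.TTheory GRing.Theory Num.Theory.
Import numFieldNormedType.Exports.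

Local Open Scope ring_scope.

(* The module [mpoly] is not imported, because its notations clash with those
   of MathComp-Analysis: [mpoly.mpoly n R] is {mpoly R[n]} and
   [mpoly.meval v p] is p.@[v]. *)
Definition polynomial_map (R : realType) (n : nat)
    (F : 'rV[R]_n -> 'rV[R]_n) : Prop :=
  exists p : 'I_n -> mpoly.mpoly n R,
    forall (X : 'rV[R]_n) (k : 'I_n),
      F X 0 k = mpoly.meval (fun i : 'I_n => X 0 i) (p k).

Definition invertible_polynomial_map (R : realType) (n : nat)
    (F : 'rV[R]_n -> 'rV[R]_n) : Prop :=
  polynomial_map F /\
  exists G : 'rV[R]_n -> 'rV[R]_n,
    [/\ polynomial_map G, cancel F G & cancel G F].

(* Points are row vectors, so [jacobian F X] is the transpose of the usual
   Jacobian matrix; the determinant is the same. *)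
Definition jacobian_conjecture_true_for (R : realType) (n : nat)
    (F : 'rV[R]_n -> 'rV[R]_n) : Prop :=
  (exists2 c : R, c != 0 & forall X : 'rV[R]_n, \det (jacobian F X) = c) ->
  invertible_polynomial_map F.

Definition sum_perturbation (R : realType) (n m : nat)
    (alpha : nat -> R) (gamma : 'I_n -> R) (X : 'rV[R]_n) : 'rV[R]_n :=
  \row_(k < n)
    (X 0 k +
     gamma k * \sum_(2 <= j < m.+1) alpha j * (\sum_(i < n) X 0 i) ^+ j).

(* Main.v *)
Require Import Defs.
From mathcomp Require Import all_boot all_order all_algebra.
From mathcomp Require mpoly.
From mathcomp Require Import all_classical all_reals all_analysis.

Import Order.TTheory GRing.Theory Num.Theory.
Import numFieldNormedType.Exports.
(* Importing without the notations makes the ring structure of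
   [mpoly.mpoly n R] available to inference. *)
Import -(notations,coercions) mpoly.

Local Open Scope ring_scope.

(** The perturbation [f] moves [X] by a multiple of [gamma] that depends only
    on the coordinate sum [x_1 + ... + x_n].  As the entries of [gamma] add up
    to zero, [f] preserves this sum.  So a second map of the same form, with
    direction [delta], sees the same sum, hence the same value of the bracket,
    and the two displacements add up: directions add under composition
    ([sum_perturbation_comp]).  The inverse of [f] is therefore the perturbation
    in direction [- gamma], which is again polynomial.

    The hypothesis on the determinants says that [A] and [B] are linear
    isomorphisms.  Invertible polynomial maps contain these
    ([invertible_polynomial_map_linear]) and are closed under composition
    ([invertible_polynomial_map_comp]), which gives the result for
    [A \o f \o B]. *)

(** Composition of maps is substitution of polynomials. *)
Lemma polynomial_map_comp (R : realType) (n : nat)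
    (F G : 'rV[R]_n -> 'rV[R]_n) :
  polynomial_map F -> polynomial_map G -> polynomial_map (F \o G).
Proof.
move=> [p Fp] [q Gq]; exists (fun k => comp_mpoly [tuple q i | i < n] (p k)).
move=> X k; rewrite /= Fp comp_mpoly_meval; apply: meval_eq => i.
by rewrite Gq tnth_mktuple.
Qed.

Lemma polynomial_map_linear (R : realType) (n : nat)
    (L : {linear 'rV[R]_n -> 'rV[R]_n}) : polynomial_map L.
Proof.
exists (fun k => \sum_(i < n) lin1_mx L i k *: mpolyX R (mnm1 i)) => X k.
rewrite -[L X]mul_rV_lin1 mxE raddf_sum; apply: eq_bigr => i _ /=.
by rewrite mevalZ mevalXU mulrC.
Qed.

Lemma invertible_polynomial_map_comp (R : realType) (n : nat)
    (F G : 'rV[R]_n -> 'rV[R]_n) :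
  invertible_polynomial_map F -> invertible_polynomial_map G ->
  invertible_polynomial_map (F \o G).
Proof.
move=> [polF [F' [polF' FK F'K]]] [polG [G' [polG' GK G'K]]].
split; first exact: polynomial_map_comp.
by exists (G' \o F'); split;
  [exact: polynomial_map_comp | exact: can_comp | exact: can_comp].
Qed.

Lemma invertible_polynomial_map_linear (R : realType) (n : nat)
    (L : {linear 'rV[R]_n -> 'rV[R]_n}) :
  \det (lin1_mx L) != 0 -> invertible_polynomial_map L.
Proof.
move=> detL; have unitL : lin1_mx L \in unitmx by rewrite unitmxE unitfE.
split; first exact: polynomial_map_linear.
exists (mulmxr (invmx (lin1_mx L))); split.
- exact: polynomial_map_linear.
- by move=> X; rewrite /= -(mul_rV_lin1 L) mulmxK.
- by move=> X; rewrite /= -(mul_rV_lin1 L) mulmxKV.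
Qed.

Lemma polynomial_map_sum_perturbation (R : realType) (n m : nat)
    (alpha : nat -> R) (gamma : 'I_n -> R) :
  polynomial_map (sum_perturbation m alpha gamma).
Proof.
exists (fun k => mpolyX R (mnm1 k) + gamma k *: \sum_(2 <= j < m.+1)
  alpha j *: (\sum_(i < n) mpolyX R (mnm1 i)) ^+ j) => X k.
rewrite mxE mevalD mevalXU mevalZ raddf_sum; congr (_ + _ * _).
apply: eq_bigr => j _ /=; rewrite mevalZ rmorphXn raddf_sum.
by congr (_ * _ ^+ _); apply: eq_bigr => i _ /=; rewrite mevalXU.
Qed.

(** The total displacement is a multiple of the sum of the [gamma k]. *)
Lemma sum_perturbation_sum (R : realType) (n m : nat)
    (alpha : nat -> R) (gamma : 'I_n -> R) (X : 'rV[R]_n) :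
  \sum_(k < n) gamma k = 0 ->
  \sum_(k < n) sum_perturbation m alpha gamma X 0 k = \sum_(k < n) X 0 k.
Proof.
move=> gamma0; under eq_bigr do rewrite mxE.
by rewrite big_split /= -mulr_suml gamma0 mul0r addr0.
Qed.

(** The inner map leaves the coordinate sum unchanged, so both maps displace
    by the same polynomial value, along [gamma] and along [delta]. *)
Lemma sum_perturbation_comp (R : realType) (n m : nat)
    (alpha : nat -> R) (gamma delta : 'I_n -> R) (X : 'rV[R]_n) :
  \sum_(k < n) gamma k = 0 ->
  sum_perturbation m alpha delta (sum_perturbation m alpha gamma X) =
  sum_perturbation m alpha (fun k => gamma k + delta k) X.
Proof.
move=> gamma0; apply/rowP => k.
rewrite mxE sum_perturbation_sum // !mxE.
by rewrite -addrA -mulrDl.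
Qed.

Lemma sum_perturbation_id (R : realType) (n m : nat)
    (alpha : nat -> R) (gamma : 'I_n -> R) (X : 'rV[R]_n) :
  gamma =1 (fun=> 0) -> sum_perturbation m alpha gamma X = X.
Proof. by move=> gamma0; apply/rowP => k; rewrite mxE gamma0 mul0r addr0. Qed.

Lemma invertible_sum_perturbation (R : realType) (n m : nat)
    (alpha : nat -> R) (gamma : 'I_n -> R) :
  \sum_(k < n) gamma k = 0 ->
  invertible_polynomial_map (sum_perturbation m alpha gamma).
Proof.
move=> gamma0; split; first exact: polynomial_map_sum_perturbation.
exists (sum_perturbation m alpha (fun k => - gamma k)); split.
- exact: polynomial_map_sum_perturbation.
- move=> X; rewrite sum_perturbation_comp // sum_perturbation_id // => k.
  exact: subrr.
- move=> X; rewrite sum_perturbation_comp; last by rewrite sumrN gamma0 oppr0.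
  by rewrite sum_perturbation_id // => k; exact: addNr.
Qed.

Theorem theorem1 (R : realType) (n m : nat) (hn : (1 <= n)%N) (hm : (1 <= m)%N)
    (alpha : nat -> R) (gamma : 'I_n -> R)
    (hgamma : \sum_(k < n) gamma k = 0)
    (A B : {linear 'rV[R]_n -> 'rV[R]_n})
    (hAB : \det (lin1_mx A) * \det (lin1_mx B) != 0) :
  jacobian_conjecture_true_for (A \o sum_perturbation m alpha gamma \o B).
Proof.
move=> _; move: hAB; rewrite mulf_eq0 negb_or => /andP[detA detB].
apply: invertible_polynomial_map_comp; last first.
  exact: invertible_polynomial_map_linear.
apply: invertible_polynomial_map_comp.
  exact: invertible_polynomial_map_linear.
exact: invertible_sum_perturbation.
Qed.
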